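(* Let $B$ be a basis such that $E_B = A_B^{-1}D_B$ is diagonalizable, and let $E_B = Q\Sigma Q^{-1}$ be its eigendecomposition ($Q$ an invertible matrix of eigenvectors of $E_B$, $\Sigma$ the diagonal matrix of the associated eigenvalues). Then, for any $\lambda$ such that $I+\lambda E_B$ is invertible, $$x_B(\lambda) = Q(I+\lambda\Sigma)^{-1}Q^{-1}x_B(0).$$
   Context: Let $A, D \in \mathbb{R}^{m\times n}$, $b\in\mathbb{R}^m$, $c\in\mathbb{R}^n$, and for $\lambda\in\mathbb{R}$ let $\mathcal{P}(\lambda)$ be the linear program $\min\{c^T x : Ax+\lambda Dx=b,\ x\ge 0\}$. A basis $B$ is a choice of $m$ column indices such that $A_B$ is invertible; for a matrix $M$ with $n$ columns, $M_B$ (resp. $M_N$) is the submatrix formed by the columns in $B$ (resp. not in $B$). Whenever $A_B+\lambda D_B$ is invertible (equivalently $I+\lambda E_B$ is invertible), $x_B(\lambda) = (A_B+\lambda D_B)^{-1}b$; in particular $x_B(0)=A_B^{-1}b$. Eigendecompositions are over $\mathbb{C}$; $I$ is the $m\times m$ identity. *)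

(* Defs.v *)
From HB Require Import structures.
From mathcomp Require Import all_boot all_order all_algebra.
From mathcomp Require Import reals complex.

Set Implicit Arguments.
Unset Strict Implicit.
Unset Printing Implicit Defensive.

Import GRing.Theory.
Local Open Scope ring_scope.

(* A basis is encoded by the listing [B : 'I_m -> 'I_n] of its m column
   indices, in an arbitrary order; the submatrix M_B is [colsub B M]. *)
Definition is_basis (R : realType) (m n : nat) (A : 'M[R]_(m, n))
    (B : 'I_m -> 'I_n) : Prop :=
  injective B /\ colsub B A \in unitmx.

Definition E_B (R : realType) (m n : nat) (A D : 'M[R]_(m, n))
    (B : 'I_m -> 'I_n) : 'M[R]_m :=
  invmx (colsub B A) *m colsub B D.

(* [invmx M] is [M] itself when [M] is singular, so this is the basic solution
   only when [colsub B A + lambda *: colsub B D] is invertible. *)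
Definition x_B (R : realType) (m n : nat) (A D : 'M[R]_(m, n)) (b : 'cV[R]_m)
    (B : 'I_m -> 'I_n) (lambda : R) : 'cV[R]_m :=
  invmx (colsub B A + lambda *: colsub B D) *m b.

Definition toC (R : realType) (m n : nat) (M : 'M[R]_(m, n)) :
    'M[complex R]_(m, n) :=
  map_mx (real_complex R) M.

(* The equation reads E Q = Q Sigma: column j of Q is an eigenvector of E
   (nonzero, as Q is invertible) for the eigenvalue Sigma j j. *)
Definition is_eigendecomposition (F : fieldType) (m : nat)
    (E Q Sigma : 'M[F]_m) : Prop :=
  [/\ Q \in unitmx, is_diag_mx Sigma & E = Q *m Sigma *m invmx Q].

(* Main.v *)
Require Import Defs.
From mathcomp Require Import all_boot all_order all_algebra.
From mathcomp Require Import reals complex.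

Import GRing.Theory.
Local Open Scope ring_scope.

(** Factoring [A_B] out of the basis matrix gives
    [x_B(lambda) = (1 + lambda E_B)^-1 x_B(0)] already over the reals: this is
    [x_B_resolvent]. Over the complex numbers, conjugation by [Q] is a
    ring automorphism carrying [1 + lambda Sigma] to [1 + lambda E_B], so it
    commutes with inversion ([invmx_conj]); since extension of scalars also
    commutes with inversion, the formula follows. *)

Lemma invmxM (R : comUnitRingType) (m : nat) (M N : 'M[R]_m) :
  M \in unitmx -> N \in unitmx -> invmx (M *m N) = invmx N *m invmx M.
Proof.
move=> uM uN; have uMN : M *m N \in unitmx by rewrite unitmx_mul uM.
apply: (can_inj (mulKmx uMN)).
by rewrite mulmxV // mulmxA mulmxK // mulmxV.
Qed.

(** For invertible [M] this is the inverse of a product. For singular [M] both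
    sides are [Q M Q^-1], because [invmx] fixes singular matrices and
    conjugation by [Q] preserves singularity. *)
Lemma invmx_conj (R : comUnitRingType) (m : nat) (Q M : 'M[R]_m) :
  Q \in unitmx -> invmx (Q *m M *m invmx Q) = Q *m invmx M *m invmx Q.
Proof.
move=> uQ; have uQV : invmx Q \in unitmx by rewrite unitmx_inv.
have [uM | nuM] := boolP (M \in unitmx).
  by rewrite !invmxM ?unitmx_mul ?uQ // invmxK mulmxA.
have nuC : Q *m M *m invmx Q \notin unitmx.
  by rewrite !unitmx_mul uQ uQV (negbTE nuM).
by rewrite (invmx_out nuC) (invmx_out nuM).
Qed.

Lemma conj_add1Z (R : comUnitRingType) (m : nat) (a : R) (Q M : 'M[R]_m) :
  Q \in unitmx ->
  1%:M + a *: (Q *m M *m invmx Q) = Q *m (1%:M + a *: M) *m invmx Q.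
Proof.
by move=> uQ; rewrite mulmxDr mulmxDl mulmx1 mulmxV // -scalemxAr -scalemxAl.
Qed.

(** [A_B + lambda D_B = A_B (1 + lambda E_B)], and inverting this product leaves
    the factor [A_B^-1 b = x_B(0)] on the right. *)
Lemma x_B_resolvent (R : realType) (m n : nat) (A D : 'M[R]_(m, n))
    (b : 'cV[R]_m) (B : 'I_m -> 'I_n) (lambda : R) :
  colsub B A \in unitmx -> 1%:M + lambda *: E_B A D B \in unitmx ->
  x_B A D b B lambda = invmx (1%:M + lambda *: E_B A D B) *m x_B A D b B 0.
Proof.
move=> uA uE; rewrite /x_B scale0r addr0 mulmxA -invmxM //.
by rewrite mulmxDr mulmx1 -scalemxAr /E_B mulKVmx.
Qed.

Theorem theorem1 (R : realType) (m n : nat) (A D : 'M[R]_(m, n))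
    (b : 'cV[R]_m) (B : 'I_m -> 'I_n) (Q Sigma : 'M[complex R]_m)
    (hB : is_basis A B)
    (hdiag : diagonalizable (toC (E_B A D B)))
    (hdec : is_eigendecomposition (toC (E_B A D B)) Q Sigma)
    (lambda : R)
    (hlambda : 1%:M + lambda *: E_B A D B \in unitmx) :
  toC (x_B A D b B lambda) =
    Q *m invmx (1%:M + real_complex R lambda *: Sigma) *m invmx Q
      *m toC (x_B A D b B 0).
Proof.
case: hB => _ uA; case: hdec => uQ _ eqE.
rewrite x_B_resolvent // -invmx_conj // -conj_add1Z // -eqE /toC.
by rewrite map_mxM map_invmx map_mxD map_mx1 map_mxZ.
Qed.
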